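(* Let $X$ be a Banach space and let $Y\subseteq X$ be a (closed) subspace. Suppose that $X$ has the approximation property. Then the following are equivalent: (1) The pair $(X,Y)$ has the approximation property. (2) For every nuclear operator $T\in N(X)$ for which $TX\subseteq Y$ and $TY=\{0\}$, we have $\operatorname{tr}(T)=0$.
   Context: $L(X)$ is the space of bounded linear operators on the Banach space $X$, and $\tau$ is the topology on $L(X)$ of uniform convergence on compact subsets of $X$. Subspaces are closed. A Banach space $X$ has the approximation property (AP) if the identity on $X$ is the $\tau$-limit of a net of finite rank bounded linear operators on $X$. For a subspace $Y$ of $X$, the pair $(X,Y)$ has the approximation property (AP) if the identity on $X$ is the $\tau$-limit of a net of finite rank bounded linear operators on $X$ all of which leave $Y$ invariant (i.e. each operator $S$ of the net satisfies $SY\subseteq Y$). $N(X)$ denotes the nuclear operators from $X$ to $X$, i.e. the operators $T$ that can be written as $Tx=\sum_{n=1}^\infty x_n^*(x)\,x_n$ with $x_n^*\in X^*$, $x_n\in X$ and $\sum_n\|x_n^*\|\,\|x_n\|<\infty$. The trace is $\operatorname{tr}(T)=\sum_n x_n^*(x_n)$; when $X$ has the AP this does not depend on the chosen representation of $T$ (Grothendieck). *)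

(* Defs.v *)
From HB Require Import structures.
From mathcomp Require Import all_boot all_order all_algebra.
From mathcomp Require Import all_classical all_reals all_analysis.

Set Implicit Arguments.
Unset Strict Implicit.
Unset Printing Implicit Defensive.

Import Order.TTheory GRing.Theory Num.Theory.
Import numFieldNormedType.Exports.
Local Open Scope classical_set_scope.
Local Open Scope ring_scope.

Definition directed_preorder (I : Type) (le : I -> I -> Prop) : Prop :=
  [/\ inhabited I,
      forall i, le i i,
      forall i j k, le i j -> le j k -> le i k &
      forall i j, exists k, le i k /\ le j k].

(** The filter of tails of a directed index set: a net [S] tends to [l] when
    [S @ net_tails le --> l]. *)
Definition net_tails (I : Type) (le : I -> I -> Prop) : set_system I :=
  [set A | exists i, forall j, le i j -> A j].

(** The scalar field [K] is arbitrary so that the same definitions serve for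
    real and for complex Banach spaces. *)
Section ApproximationProperty.
Variables (K : numFieldType) (X : normedModType K).
Implicit Types (S T : {linear X -> X}) (Y : set X).

(** [bounded_near] at 0 is boundedness in operator norm (see
    [linear_boundedP]). *)
Definition bounded_operator S : Prop := bounded_near S (nbhs (0 : X)).

Definition bounded_functional (f : {linear X -> K^o}) : Prop :=
  bounded_near f (nbhs (0 : X)).

Definition finite_rank S : Prop :=
  exists n (v : 'I_n -> X), forall x, exists c : 'I_n -> K,
    S x = \sum_(i < n) c i *: v i.

Definition closed_subspace Y : Prop :=
  closed Y /\ GRing.submod_closed (mem Y).

(** [{family compact, F --> g}] is convergence uniformly on compact sets. *)
Definition identity_is_net_limit (P : {linear X -> X} -> Prop) : Prop :=
  exists (I : Type) (le : I -> I -> Prop) (S : I -> {linear X -> X}),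
    [/\ directed_preorder le,
        forall i, P (S i) &
        {family compact, (fun i => S i : X -> X) @ net_tails le --> idfun}].

Definition approximation_property : Prop :=
  identity_is_net_limit (fun S => bounded_operator S /\ finite_rank S).

Definition pair_approximation_property Y : Prop :=
  identity_is_net_limit (fun S =>
    [/\ bounded_operator S, finite_rank S & S @` Y `<=` Y]).

(** The supremum is taken in [K]; for [K] complex the values [`|f x|] and all
    upper bounds are nonnegative real elements of [K]. *)
Definition functional_norm (f : {linear X -> K^o}) : K :=
  supremum 0 [set `|f x| | x in [set x : X | `|x| <= 1]].

Definition nuclear_representation T
    (f : nat -> {linear X -> K^o}) (v : nat -> X) : Prop :=
  [/\ forall n, bounded_functional (f n),
      cvgn (series (fun n => functional_norm (f n) * `|v n|)) &
      forall x, series (fun n => (f n x : K) *: v n) @ \oo --> T x].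

Definition nuclear T : Prop :=
  bounded_operator T /\ exists f v, nuclear_representation T f v.

(** The sum [\sum_n f n (v n)] for a representation of [T]; [xget] selects one
    of the possible values, which is the only one when [X] has the
    approximation property. *)
Definition nuclear_trace T : K :=
  xget 0 [set t : K | exists f v, nuclear_representation T f v /\
    series (fun n => f n (v n) : K) @ \oo --> t].

End ApproximationProperty.

(* Main.v *)
Require Import Defs.
From HB Require Import structures.
From mathcomp Require Import all_boot all_order all_algebra.
From mathcomp Require Import all_classical all_reals all_analysis.
From mathcomp Require Import complex.
From mathcomp Require Import ring lra.

(** If [T X <= Y] and [T Y = 0], then [T U T = 0] for every finite rank [U]
    leaving [Y] invariant, so that the trace of [T U] vanishes; and the trace of
    [T] is the limit of the traces of [T U] as [U] tends to the identity
    uniformly on compact sets.  Conversely, if no such [U] is close to the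
    identity on some compact set, put that set in the hull of a null sequence [v]
    and apply Hahn-Banach in c_0(X) to separate [v] from the subspace of
    sequences [U v].  The resulting functional is [u |-> \sum_n f n (u n)] with
    summable [f n], and [T x = \sum_n f n x *: v n] has trace 1; testing on rank
    one operators [U] gives [T X <= Y] and [T Y = 0]. *)

Set Implicit Arguments.
Unset Strict Implicit.
Unset Printing Implicit Defensive.

Import Order.TTheory GRing.Theory Num.Theory.
Import numFieldNormedType.Exports.
Local Open Scope classical_set_scope.
Local Open Scope ring_scope.
Local Open Scope complex_scope.

(** A nuclear representation bounds only the sum of the products of the norms of [f n] and [v n]. To
    compare the traces of [T] and [T U] by the size of [U x - x] on one compact set, the weights are
    redistributed so that the vectors tend to 0 while the functionals stay summable. Finite rank
    turns [T U T = 0] into matrices: if [U] is the sum of the [g i] tensor [w i], the trace of [T U]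
    is that of the matrix of the [g i (T (w j))], whose square has the entries
    [g i (T (U (T (w k))))]. Separation takes place in c_0(X) because its dual consists of summable
    sequences of functionals: evaluated at the sequence [U (v n)], the separating functional is
    already the trace of [U T]. It is 0 for admissible [U] and 1 for the identity. The approximation
    property of [X] makes the trace unique, so that the value 1 read off from one representation is
    [nuclear_trace T]. *)

(** What the proof needs of the scalar field: [emb] and [re] are the inclusion of
    the reals and the real part, and [lift_real_linear] is the passage from a
    real-linear [g] to the complex-linear [x |-> g x - i g (i x)]. *)
Record scalars (R : realType) (K : numFieldType) := Scalars {
  emb : {rmorphism R -> K};
  re : K -> R;
  embK : forall r, re (emb r) = r;
  reM : forall r z, re (emb r * z) = r * re z;
  reK : forall z, 0 <= z -> emb (re z) = z;
  emb_le : forall r s, (emb r <= emb s) = (r <= s);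
  lift_real_linear : forall (V : lmodType K) (g : V -> R),
    (forall x y, g (x + y) = g x + g y) ->
    (forall t x, g (emb t *: x) = t * g x) ->
    exists f : {linear V -> K^o}, forall x, re (f x) = g x }.

Lemma linear_pack (K : pzRingType) (V W : lmodType K) (f : V -> W) :
  linear f -> exists F : {linear V -> W}, F =1 f.
Proof.
move=> lf; pose L := GRing.isLinear.Build K V W _ f lf.
by exists (HB.pack_for {linear V -> W} f L).
Qed.

Lemma real_scalars (R : realType) : scalars R R.
Proof.
apply: (@Scalars R R idfun id) => // V g gD gZ.
have [f fE] : exists f : {linear V -> R^o}, f =1 g.
  by apply: (@linear_pack R V R^o) => a x y; rewrite gD gZ.
by exists f => x; rewrite fE.
Qed.

Lemma complex_lift (R : realType) (V : lmodType R[i]) (g : V -> R) :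
  (forall x y, g (x + y) = g x + g y) ->
  (forall (t : R) x, g (t%:C *: x) = t * g x) ->
  exists f : {linear V -> R[i]^o}, forall x, complex.Re (f x) = g x.
Proof.
move=> gD gZ.
have [f fE] : exists f : {linear V -> R[i]^o},
    f =1 (fun x => g x +i* - g ('i *: x)).
  apply: (@linear_pack R[i] V R[i]^o) => -[a b] x y.
  have abE : forall z : V, (a +i* b) *: z = a%:C *: z + b%:C *: ('i *: z).
    move=> z; rewrite scalerA -scalerDl; congr (_ *: _).
    by apply/eqP; rewrite eq_complex /=; apply/andP; split; apply/eqP; ring.
  have iab : 'i *: ((a +i* b) *: x) = a%:C *: ('i *: x) - b%:C *: x.
    rewrite !scalerA -scalerBl; congr (_ *: _).
    by apply/eqP; rewrite eq_complex /=; apply/andP; split; apply/eqP; ring.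
  have gN z : g (- z) = - g z.
    by rewrite -scaleN1r (_ : -1 = (-1)%:C) ?gZ ?mulN1r // rmorphN1.
  rewrite scalerDr iab !gD abE !gD gN !gZ.
  apply/eqP; rewrite eq_complex /=; apply/andP; split; apply/eqP; ring.
by exists f => x; rewrite fE.
Qed.

Lemma complex_scalars (R : realType) : scalars R R[i].
Proof.
apply: (@Scalars R R[i] (real_complex R) (@complex.Re R)) => //.
- by move=> r [a b]; rewrite /= mul0r subr0.
- by move=> [a b] /ger0_Im /= ->.
- by move=> r s; rewrite lecR.
exact: complex_lift.
Qed.

(** * Hahn-Banach over the reals and the complex numbers *)

Section HahnBanach.
Variables (R : realType) (K : numFieldType) (S : scalars R K).
Variable (V : lmodType K).
Local Notation "t %:K" := (emb S t) (at level 1, format "t %:K").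

Definition sublinear (p : V -> R) :=
  (forall x y, p (x + y) <= p x + p y) /\
  (forall t x, 0 < t -> p (t%:K *: x) <= t * p x).

Lemma sublinear0 p : sublinear p -> p 0 = 0.
Proof.
move=> [_ pZ]; apply/le_anti.
have := pZ 2^-1 0; have := pZ 2 0.
rewrite !scaler0 invr_gt0 !ltr0n => /(_ isT) h1 /(_ isT) h2.
by apply/andP; split; lra.
Qed.

Lemma sublinearZ p t x : sublinear p -> 0 <= t -> p (t%:K *: x) = t * p x.
Proof.
move=> sp; rewrite le_eqVlt => /predU1P[<-|t0].
  by rewrite rmorph0 scale0r mul0r sublinear0.
apply/le_anti; rewrite sp.2//=.
have := sp.2 t^-1 (t%:K *: x); rewrite invr_gt0 => /(_ t0).
by rewrite scalerA -rmorphM mulVf ?gt_eqF// rmorph1 scale1r ler_pdivlMl.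
Qed.

Lemma sublinear_ge p x : sublinear p -> - p (- x) <= p x.
Proof.
move=> sp; have := sp.1 x (- x); rewrite subrr sublinear0//; lra.
Qed.

(** An infimum of sublinear functions need not be subadditive; it is when two indices, one used at
    [x] and one at [y], can be merged into a single one for [x + y]. This covers [pull], the infimum
    of a chain, and the distance to a subspace. *)
Lemma inf_sublinear (I : Type) (D : set I) (F : I -> V -> R) :
  D !=set0 ->
  (forall x, exists l, forall i, D i -> l <= F i x) ->
  (forall i j x y, D i -> D j ->
    exists2 k, D k & F k (x + y) <= F i x + F j y) ->
  (forall i t x, 0 < t -> D i ->
    exists2 k, D k & F k (t%:K *: x) <= t * F i x) ->
  sublinear (fun x => inf [set F i x | i in D]).
Proof.
move=> [i0 Di0] Flb FD FZ.
have ne x : [set F i x | i in D] !=set0 by exists (F i0 x), i0.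
have lb x : has_lbound [set F i x | i in D].
  by have [l Hl] := Flb x; exists l => _ [i Di <-]; exact: Hl.
have infle x i : D i -> inf [set F i x | i in D] <= F i x.
  by move=> Di; apply: ge_inf; [exact: lb|exists i].
split=> [x y|t x t0].
- rewrite -lerBlDr; apply: lb_le_inf => // _ [i Di <-].
  rewrite lerBlDr -lerBlDl; apply: lb_le_inf => // _ [j Dj <-].
  rewrite lerBlDl; have [k Dk Fk] := FD i j x y Di Dj.
  exact: le_trans (infle _ _ Dk) Fk.
- rewrite -ler_pdivrMl//; apply: lb_le_inf => // _ [i Di <-].
  rewrite ler_pdivrMl//; have [k Dk Fk] := FZ i t x t0 Di.
  exact: le_trans (infle _ _ Dk) Fk.
Qed.

(** For sublinear [p], the largest sublinear functional below [p] whose value at [- y] is at most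
    [- p y]. Any linear functional below it therefore agrees with [p] at [y]. *)
Definition pull (p : V -> R) y x : R :=
  inf [set p (x + t%:K *: y) - t * p y | t in [set t | 0 <= t]].

Lemma pull_le p y x t : sublinear p -> 0 <= t ->
  pull p y x <= p (x + t%:K *: y) - t * p y.
Proof.
move=> sp t0; apply: ge_inf; last by exists t.
exists (- p (- x)) => _ [s /= s0 <-].
have := sp.1 (x + s%:K *: y) (- x).
by rewrite addrAC subrr add0r sublinearZ//; lra.
Qed.

Lemma pull_sublinear p y : sublinear p -> sublinear (pull p y).
Proof.
move=> sp; apply: (@inf_sublinear _ _ (fun t x => p (x + t%:K *: y) - t * p y)).
- by exists 0 => /=.
- move=> x; exists (- p (- x)) => s /= s0.
  have := sp.1 (x + s%:K *: y) (- x).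
  by rewrite addrAC subrr add0r sublinearZ//; lra.
- move=> s t x z /= s0 t0; exists (s + t); first exact: addr_ge0.
  have := sp.1 (x + s%:K *: y) (z + t%:K *: y).
  by rewrite addrACA -scalerDl -rmorphD; lra.
- move=> s t x /= t0 s0; exists (t * s); first exact/mulr_ge0/s0/ltW.
  rewrite rmorphM -scalerA -scalerDr sublinearZ ?(ltW t0)//.
  by rewrite mulrBr mulrA.
Qed.

(* A minimal element [q] of the sublinear functionals below [p] is linear,
   because [pull q y <= q] is again sublinear. *)
Lemma exists_linear_below p : sublinear p -> exists g : V -> R,
  [/\ forall x y, g (x + y) = g x + g y,
      forall t x, g (t%:K *: x) = t * g x &
      forall x, g x <= p x].
Proof.
move=> sp.
pose T := {q : V -> R | sublinear q /\ forall x, q x <= p x}.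
(* The order is reversed, so that the maximal element given by Zorn's lemma is a pointwise minimal
   functional. *)
pose Rl (a b : T) := `[< forall x, sval b x <= sval a x >].
pose mk q h : T := exist (fun q => sublinear q /\ forall x, q x <= p x) q h.
pose t0 : T := exist _ p (conj sp (fun x => lexx _)).
have [|||q qmin] := @ZL_preorder T t0 Rl.
- by move=> t; apply/asboolP.
- move=> r s t /asboolP rs /asboolP st; apply/asboolP => x.
  exact: le_trans (st x) (rs x).
- move=> A totA; have [[a Aa]|A0] := pselect (A !=set0); last first.
    by exists t0 => s As; exfalso; apply: A0; exists s.
  have lb x : forall i, A i -> - p (- x) <= sval i x.
    move=> i _; apply: le_trans (sublinear_ge x (svalP i).1).
    by rewrite lerN2; exact: (svalP i).2.
  have sq : sublinear (fun x => inf [set sval i x | i in A]).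
    apply: inf_sublinear.
    + by exists a.
    + by move=> x; exists (- p (- x)); exact: lb.
    + move=> i j x y Ai Aj; case: (totA i j Ai Aj) => /asboolP le.
        exists j => //; apply: le_trans ((svalP j).1.1 _ _) _.
        by rewrite lerD2r.
      exists i => //; apply: le_trans ((svalP i).1.1 _ _) _.
      by rewrite lerD2l.
    + by move=> i t x t1 Ai; exists i => //; exact: (svalP i).1.2.
  have qle i x : A i -> inf [set sval i x | i in A] <= sval i x.
    move=> Ai; apply: ge_inf; last by exists i.
    by exists (- p (- x)) => _ [j Aj <-]; exact: lb.
  have qp x : inf [set sval i x | i in A] <= p x.
    exact: le_trans (qle _ _ Aa) ((svalP a).2 x).
  exists (mk _ (conj sq qp)) => s As; apply/asboolP => x /=.
  exact: qle.
have sq := (svalP q).1.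
have qD x y : sval q (x + y) = sval q x + sval q y.
  apply/le_anti; rewrite sq.1/=.
  have pp z : pull (sval q) y z <= sval q z.
    have := @pull_le _ y z 0 sq (lexx 0).
    by rewrite rmorph0 scale0r addr0 mul0r subr0.
  have ppp z : pull (sval q) y z <= p z.
    exact: le_trans (pp z) ((svalP q).2 z).
  (* Minimality gives [q x <= pull q y x], and the term [t = 1] of the infimum bounds this by
     [q (x + y) - q y]: superadditivity. *)
  have /asboolP/(_ x)/= := qmin (mk _ (conj (pull_sublinear y sq) ppp))
    (asboolT pp).
  have := @pull_le _ y x 1 sq ler01; rewrite rmorph1 scale1r mul1r; lra.
have qN x : sval q (- x) = - sval q x.
  by have := qD x (- x); rewrite subrr sublinear0//; lra.
exists (sval q); split => // [t x|]; last exact: (svalP q).2.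
have [t0'|/ltW t0'] := leP 0 t; first exact: sublinearZ.
have := @sublinearZ _ (- t) x sq; rewrite oppr_ge0 => /(_ t0').
by rewrite rmorphN scaleNr qN mulNr => /oppr_inj.
Qed.

Lemma exists_linear_support p x0 : sublinear p -> exists g : V -> R,
  [/\ forall x y, g (x + y) = g x + g y,
      forall t x, g (t%:K *: x) = t * g x,
      forall x, g x <= p x &
      g x0 = p x0].
Proof.
move=> sp; have [g [gD gZ gle]] := exists_linear_below (pull_sublinear x0 sp).
have gp x : g x <= p x.
  apply: le_trans (gle x) _.
  have := @pull_le _ x0 x 0 sp (lexx 0).
  by rewrite rmorph0 scale0r addr0 mul0r subr0.
exists g; split => //; apply/le_anti; rewrite gp/=.
have := @pull_le _ x0 (- x0) 1 sp ler01.
rewrite rmorph1 scale1r addNr sublinear0// mul1r add0r.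
have := gZ (-1) x0; rewrite rmorphN1 scaleN1r => g1 h.
by have := gle (- x0); rewrite g1; lra.
Qed.

(** The norm [`|x|] as an element of [R] rather than of [K]. *)
Definition nrm (W : normedModType K) (x : W) : R := re S `|x|.

Definition seminorm (N : V -> R) :=
  (forall x y, N (x + y) <= N x + N y) /\
  (forall a x, N (a *: x) = re S `|a| * N x).

Lemma normE (W : normedModType K) (x : W) : `|x| = (nrm x)%:K.
Proof. by rewrite reK. Qed.

(** Take a functional supporting at [v] the distance to [M]. This distance is 0 on [M] and at least
    [e] at [v], so the functional can be rescaled to the value 1 at [v]; [C] is the rescaling
    factor. *)
Lemma hahn_banach (N : V -> R) (M : set V) (v : V) (e : R) :
  seminorm N -> M 0 ->
  (forall x y, M x -> M y -> M (x + y)) -> (forall a x, M x -> M (a *: x)) ->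
  0 < e -> (forall m, M m -> e <= N (v - m)) ->
  exists (f : {linear V -> K^o}) (C : R),
    [/\ 0 < C, forall m, M m -> f m = 0, f v = 1 &
        forall x, (`|f x : K| <= (C * N x)%:K)].
Proof.
move=> [ND NZ] M0 MD MZ e0 Ne.
have emb0 r : 0 <= r -> `|r%:K| = r%:K.
  by move=> r0; rewrite ger0_norm// -(rmorph0 (emb S)) emb_le.
have N_ge0 x : 0 <= N x.
  have N0 : N 0 = 0.
    rewrite -[X in N X](scale0r 0) NZ normr0 -(rmorph0 (emb S)).
    by rewrite embK mul0r.
  have NN : N (- x) = N x.
    by rewrite -scaleN1r NZ normrN normr1 -(rmorph1 (emb S)) embK mul1r.
  by have := ND x (- x); rewrite subrr N0 NN; lra.
pose p x := inf [set N (x - m) | m in M].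
have ple x m : M m -> p x <= N (x - m).
  by move=> Mm; apply: ge_inf; [exists 0 => _ [? _ <-]|exists m].
have sp : sublinear p.
  apply: (@inf_sublinear _ M (fun m x => N (x - m))).
  - by exists 0.
  - by move=> x; exists 0.
  - move=> m n x y Mm Mn; exists (m + n); first exact: MD.
    by rewrite opprD addrACA.
  - move=> m t x t0 Mm; exists (t%:K *: m); first exact: MZ.
    by rewrite -scalerBr NZ emb0 ?(ltW t0)// embK.
have pN x : p x <= N x by have := ple x 0 M0; rewrite subr0.
have pv : e <= p v.
  by apply: lb_le_inf; [exists (N (v - 0)), 0|move=> _ [m Mm <-]; exact: Ne].
have [g [gD gZ gp gv]] := exists_linear_support v sp.
have [f fE] := lift_real_linear gD gZ.
(* A bound on the real part becomes one on the modulus by rotating [x] with the scalar [u] that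
   makes [f (u *: x)] equal to the modulus of [f x]. *)
have fN x r : (forall a, `|a| <= 1 -> g (a *: x) <= r) -> `|f x : K| <= r%:K.
  move=> gr; pose u : K := `|f x : K| / (f x : K).
  have [fx0|fx0] := eqVneq (f x : K) 0.
    rewrite fx0 normr0 -(rmorph0 (emb S)) emb_le.
    have := gr 0; rewrite normr0 scale0r ler01 -(scale0r (0 : V)).
    by rewrite -(rmorph0 (emb S)) gZ mul0r => /(_ isT).
  have u1 : `|u| <= 1 by rewrite /u normrM normfV normr_id divff// normr_eq0.
  have fu : f (u *: x) = `|f x : K| :> K by rewrite linearZ; exact: divfK.
  have := gr u u1; rewrite -fE fu -(emb_le S) => /(le_trans _); apply.
  by rewrite reK.
have fv0 : (f v : K) != 0.
  apply/eqP => fv; have := fE v.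
  rewrite fv -[0](rmorph0 (emb S)) embK gv => pv0.
  by move: pv; rewrite -pv0 leNgt e0.
have fb x : `|f x : K| <= (N x)%:K.
  apply: fN => a a1; apply: le_trans (gp _) _; apply: le_trans (pN _) _.
  by rewrite NZ ler_piMl// -(emb_le S) reK// rmorph1.
have fM m : M m -> f m = 0.
  move=> Mm; apply/normr0_eq0/le_anti; rewrite normr_ge0 andbT.
  rewrite -(rmorph0 (emb S)); apply: fN => a _; apply: le_trans (gp _) _.
  have := ple (a *: m) _ (MZ a m Mm); rewrite subrr -(scale0r (0 : V)) NZ.
  by rewrite normr0 -(rmorph0 (emb S)) embK mul0r.
have [h hE] : exists h : {linear V -> K^o}, h =1 (fun x => (f v : K)^-1 *: f x).
  apply: (@linear_pack K V K^o) => a x y.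
  by rewrite linearP scalerDr !scalerA mulrC.
exists h, (re S `|(f v : K)^-1|); split.
- have : 0 < `|(f v : K)^-1| by rewrite normr_gt0 invr_eq0.
  rewrite lt_neqAle => /andP[n0 _]; rewrite lt_neqAle; apply/andP; split.
    apply/eqP => h0; have := reK S (normr_ge0 (f v : K)^-1).
    rewrite -h0 rmorph0 => /eqP.
    by move/negP : n0.
  by rewrite -(emb_le S) rmorph0 reK.
- move=> m Mm; rewrite hE (fM m Mm); exact: mulr0.
- by rewrite hE; exact: mulVf.
- move=> x; rewrite hE normrM rmorphM reK//; apply: ler_wpM2l => //; exact: fb.
Qed.

End HahnBanach.

(** * Real-valued norms, bounded maps and finite rank operators *)

Section Norm.
Variables (R : realType) (K : numFieldType) (S : scalars R K).
Local Notation "t %:K" := (emb S t) (at level 1, format "t %:K").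
Local Notation nrm := (nrm S).

Lemma emb_lt r s : (r%:K < s%:K) = (r < s).
Proof.
rewrite !lt_neqAle emb_le; congr (~~ _ && _); apply/eqP/eqP => [|->//].
by move=> h; rewrite -(embK S r) h embK.
Qed.

Lemma emb_gt0 r : (0 < r%:K) = (0 < r).
Proof. by rewrite -emb_lt rmorph0. Qed.

Lemma emb_ge0 r : (0 <= r%:K) = (0 <= r).
Proof. by rewrite -(emb_le S) rmorph0. Qed.

Lemma re_le z w : 0 <= z -> z <= w -> re S z <= re S w.
Proof.
by move=> z0 zw; rewrite -(emb_le S) !reK//; exact: le_trans zw.
Qed.

Lemma re0 : re S 0 = 0. Proof. by rewrite -(rmorph0 (emb S)) embK. Qed.
Lemma re1 : re S 1 = 1. Proof. by rewrite -(rmorph1 (emb S)) embK. Qed.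

Lemma re_gt0 z : 0 < z -> 0 < re S z.
Proof. by move=> z0; rewrite -emb_gt0 reK// ltW. Qed.

Lemma reMpos z w : 0 <= z -> re S (z * w) = re S z * re S w.
Proof. by move=> z0; rewrite -{1}(reK S z0) reM. Qed.

Section NormTheory.
Variable W : normedModType K.
Implicit Types x y : W.

Lemma nrm_ge0 x : 0 <= nrm x.
Proof. by rewrite -emb_ge0 -(normE S). Qed.
Hint Resolve nrm_ge0 : core.

Lemma nrm0 : nrm (0 : W) = 0.
Proof. by rewrite /nrm normr0 re0. Qed.

Lemma nrm_le x r : (nrm x <= r) = (`|x| <= r%:K).
Proof. by rewrite (normE S) emb_le. Qed.

Lemma nrm_lt x r : (nrm x < r) = (`|x| < r%:K).
Proof. by rewrite (normE S) emb_lt. Qed.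

Lemma nrm_eq0 x : (nrm x == 0) = (x == 0).
Proof.
rewrite -[RHS]normr_eq0 (normE S).
apply/eqP/eqP => [->|h]; first exact: rmorph0.
by rewrite -(embK S (nrm x)) h re0.
Qed.

Lemma nrmD x y : nrm (x + y) <= nrm x + nrm y.
Proof. by rewrite nrm_le rmorphD -!(normE S) ler_normD. Qed.

Lemma nrmN x : nrm (- x) = nrm x.
Proof. by rewrite /nrm normrN. Qed.

Lemma nrmB x y : nrm (x - y) <= nrm x + nrm y.
Proof. by rewrite -(nrmN y) nrmD. Qed.

Lemma nrmBC x y : nrm (x - y) = nrm (y - x).
Proof. by rewrite -nrmN opprB. Qed.

Lemma nrmZ (a : K) x : nrm (a *: x) = nrm (a : K^o) * nrm x.
Proof. by rewrite /nrm normrZ reMpos. Qed.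

Lemma nrm_emb (r : R) : 0 <= r -> nrm (r%:K : K^o) = r.
Proof. by move=> r0; rewrite /nrm ger0_norm ?embK// emb_ge0. Qed.

Lemma nrm_triangle x y z : nrm (x - z) <= nrm (x - y) + nrm (y - z).
Proof. by apply: le_trans (nrmD _ _); rewrite addrA subrK. Qed.

Lemma nrm_sum (I : Type) (r : seq I) (P : pred I) (F : I -> W) :
  nrm (\sum_(i <- r | P i) F i) <= \sum_(i <- r | P i) nrm (F i).
Proof.
elim/big_ind2 : _ => [|x a y b xa yb|//]; first by rewrite nrm0.
exact: le_trans (nrmD _ _) (lerD xa yb).
Qed.

Lemma nrm_seminorm : seminorm S (fun x : W => nrm x).
Proof. by split; [exact: nrmD|exact: nrmZ]. Qed.

Lemma cvg_nrmP (u : nat -> W) l : (u @ \oo --> l) <->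
  (forall e : R, 0 < e -> exists N, forall n, (N <= n)%N -> nrm (l - u n) <= e).
Proof.
split=> [/cvgrPdist_le ul e e0|ul].
  have [|N _ uN] := ul e%:K; first by rewrite emb_gt0.
  by exists N => n Nn; rewrite nrm_le; exact: uN.
apply/cvgrPdist_le => e e0; have [|N uN] := ul (re S e); first exact: re_gt0.
by exists N => // n /= Nn; rewrite -(reK S (ltW e0)) -nrm_le; exact: uN.
Qed.

Lemma cvg_nrm_le (u : nat -> W) l c :
  u @ \oo --> l -> (forall n, nrm (u n) <= c) -> nrm l <= c.
Proof.
move=> /cvg_nrmP ul uc; apply/ler_addgt0Pr => e e0.
have [N /(_ N (leqnn N)) uN] := ul e e0.
have := nrmD (l - u N) (u N); rewrite subrK; have := uc N; lra.
Qed.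

Lemma cvg_nrm_unique (u : nat -> W) (l l' : W) :
  u @ \oo --> l -> u @ \oo --> l' -> l = l'.
Proof. by move=> h h'; exact: (cvg_unique (@norm_hausdorff _ _) h h'). Qed.

Lemma not_closed_dist (Y : set W) x : closed Y -> ~ Y x ->
  exists2 e : R, 0 < e & forall y, Y y -> e <= nrm (x - y).
Proof.
move=> cY Yx; have /nbhs_normP[e /= e0 eY] : nbhs x (~` Y).
  by apply: open_nbhs_nbhs; split => //; exact: closed_openC.
exists (re S e); first exact: re_gt0.
move=> y Yy; rewrite leNgt nrm_lt reK ?ltW//; apply/negP => xy.
by case: (eY y).
Qed.

End NormTheory.

Lemma bounded_nrmP (V W : normedModType K) (f : {linear V -> W}) :
  bounded_near f (nbhs (0 : V)) <->
  exists2 C, 0 <= C & forall x, nrm (f x) <= C * nrm x.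
Proof.
split=> [/linear_boundedP/pinfty_ex_gt0[r r0 fr]|[C C0 fC]].
  exists (re S r); first exact/ltW/re_gt0.
  by move=> x; rewrite nrm_le rmorphM (reK S (ltW r0)) -(normE S); exact: fr.
apply/linear_boundedP; near=> r => x.
apply: (@le_trans _ _ (C%:K * `|x|)).
  by rewrite [leLHS](normE S) [`|x|](normE S) -rmorphM emb_le.
apply: ler_wpM2r => //; near: r; apply: nbhs_pinfty_ge.
by rewrite ger0_real// emb_ge0.
Unshelve. all: by end_near. Qed.

Lemma hahn_banach_closed (X : normedModType K) (Y : set X) (x : X) :
  closed_subspace Y -> ~ Y x ->
  exists f : {linear X -> K^o},
    [/\ bounded_functional f, forall y, Y y -> f y = 0 & f x = 1].
Proof.
move=> [cY [Y0 YD]] Yx; have [e e0 xY] := not_closed_dist cY Yx.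
have {}Y0 : Y 0 by move: Y0; rewrite inE.
have YL a y z : Y y -> Y z -> Y (a *: y + z).
  by move=> Yy Yz; have := YD a y z; rewrite !inE; exact.
have [||f [C [C0 fY fx fC]]] :=
    hahn_banach (nrm_seminorm X) Y0 _ _ e0 xY.
- by move=> y z Yy Yz; rewrite -(scale1r y); exact: YL.
- by move=> a y Yy; rewrite -[_ *: _]addr0; exact: YL.
exists f; split => //; apply/bounded_nrmP; exists C; first exact: ltW.
by move=> y; rewrite nrm_le; exact: fC.
Qed.

Lemma hahn_banach_point (X : normedModType K) (x : X) : x != 0 ->
  exists2 f : {linear X -> K^o}, bounded_functional f & f x = 1.
Proof.
move=> x0; have [|/eqP|f [fb _ fx]] := @hahn_banach_closed X [set 0] x.
- split.
    apply: accessible_closed_set1.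
    exact: hausdorff_accessible (@norm_hausdorff _ _).
  by split=> [|a y z]; rewrite !inE //= => -> ->; rewrite scaler0 addr0.
- by rewrite (negbTE x0).
- by exists f.
Qed.

(** Indexing by [nat] rather than by ['I_n] lets a term be added in front by a case split on the
    index. *)
Definition tensor_sum (X : normedModType K) n (g : nat -> {linear X -> K^o})
  (w : nat -> X) (x : X) : X := \sum_(i < n) (g i x : K) *: w i.

(** The coefficients in [finite_rank] are neither linear nor continuous in [x]. To get bounded
    functionals, pick [u = U x0] nonzero and a bounded [f] with [f u = 1]. The projection
    [P x = x - f x *: u] kills [u], so [P \o U] is spanned by one vector fewer, and [U x] is
    [P (U x)] plus [f (U x) *: u]. *)
Lemma finite_rank_tensor (X : normedModType K) (U : {linear X -> X}) :
  bounded_operator U -> finite_rank U ->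
  exists n (g : nat -> {linear X -> K^o}) w,
    (forall i, bounded_functional (g i)) /\ U =1 tensor_sum n g w.
Proof.
move=> bU [n [v vU]]; elim: n => [|n IH] in U v bU vU *.
  have [z zE] : exists z : {linear X -> K^o}, z =1 (fun=> 0).
    by apply: (@linear_pack K X K^o) => a x y; rewrite scaler0 addr0.
  exists 0, (fun=> z), (fun=> 0); split => [_|x].
    by apply/bounded_nrmP; exists 0 => // x; rewrite zE nrm0 mul0r.
  by have [c ->] := vU x; rewrite /tensor_sum !big_ord0.
have [[x0 Ux0]|U0] := pselect (exists x, U x != 0); last first.
  apply: (IH U (fun=> 0) bU) => x; exists (fun=> 0).
  rewrite big1 => [|i _]; last by rewrite scaler0.
  by apply/eqP; apply/negPn/negP => Ux; apply: U0; exists x.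
have [f bf fu] := hahn_banach_point Ux0; set u := U x0 in Ux0 fu.
have [c uE] := vU x0; rewrite -/u in uE.
have [j cj] : exists j, c j != 0.
  apply/not_existsP => c0; move: Ux0; rewrite uE big1 ?eqxx// => i _.
  by have /negP/negPn/eqP -> := c0 i; rewrite scale0r.
pose P x := x - (f x : K) *: u.
have PL : linear P.
  move=> a x y; rewrite /P linearP scalerBr scalerDl opprD scalerA addrACA.
  by [].
have [P' P'E] := linear_pack PL.
have Pu : P u = 0 by rewrite /P fu scale1r subrr.
(* Apply [P] to the expansion of [u] and solve for the term [j], whose coefficient is nonzero. *)
have Pvj : P (v j) = \sum_(i < n) - (c (lift j i) / c j) *: P (v (lift j i)).
  have : P' u = 0 by rewrite P'E.
  rewrite uE linear_sum (bigD1_ord j)//= => /eqP; rewrite addr_eq0 => /eqP.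
  rewrite linearZ /= => /(congr1 (fun z => (c j)^-1 *: z)).
  rewrite scalerA mulVf// scale1r P'E => ->.
  rewrite -sumrN scaler_sumr; apply: eq_bigr => i _.
  by rewrite linearZ /= P'E -scalerN scalerA mulrC scalerN scaleNr.
have bP : exists2 C, 0 <= C & forall x, nrm (P x) <= C * nrm x.
  have /bounded_nrmP[C C0 fC] := bf; exists (1 + C * nrm u).
    by rewrite addr_ge0// mulr_ge0// nrm_ge0.
  move=> x; apply: le_trans (nrmB _ _) _; rewrite mulrDl mul1r lerD2l nrmZ.
  by rewrite mulrAC ler_wpM2r ?nrm_ge0.
have [|x|m [g [w [bg gw]]]] :=
  IH (P' \o U : {linear X -> X}) (fun i => P (v (lift j i))).
- have [C C0 PC] := bP; have /bounded_nrmP[D D0 UD] := bU.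
  apply/bounded_nrmP; exists (C * D); first exact: mulr_ge0.
  move=> x /=; rewrite P'E; apply: le_trans (PC _) _.
  by rewrite -mulrA ler_wpM2l.
- have [d dE] := vU x.
  exists (fun i => d (lift j i) - d j * (c (lift j i) / c j)).
  rewrite /= dE linear_sum (bigD1_ord j)//= linearZ /= P'E Pvj scaler_sumr.
  rewrite -big_split /=; apply: eq_bigr => i _.
  rewrite -!P'E [P' (_ *: _)]linearZ /= scalerA -scalerDl; congr (_ *: _).
  by rewrite mulrN addrC.
exists m.+1, (fun i => if i is k.+1 then g k else (f \o U : {linear X -> K^o})).
exists (fun i => if i is k.+1 then w k else u); split.
- move=> [|k]; last exact: bg.
  have /bounded_nrmP[C C0 fC] := bf; have /bounded_nrmP[D D0 UD] := bU.
  apply/bounded_nrmP; exists (C * D); first exact: mulr_ge0.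
  by move=> x /=; apply: le_trans (fC _) _; rewrite -mulrA ler_wpM2l.
- move=> x; rewrite /tensor_sum big_ord_recl /=.
  have := gw x; rewrite /= P'E /P /tensor_sum => /eqP.
  by rewrite subr_eq addrC => /eqP.
Qed.

End Norm.

(** * Nuclear representations *)

Lemma bounded_series_cvg (R : realType) (a : nat -> R) B :
  (forall n, 0 <= a n) -> (forall N, series a N <= B) ->
  exists2 l : R, series a @ \oo --> l & forall N, series a N <= l.
Proof.
move=> a0 aB.
have nd : nondecreasing_seq (series a) by apply: nondecreasing_series => n _ _.
have ca : cvgn (series a).
  by apply: nondecreasing_is_cvgn => //; exists B => _ [n _ <-].
by exists (limn (series a)) => // N; exact: nondecreasing_cvgn_le.
Qed.

(* With the tails [r n] of the series [a], take [m n] the square root of [r n]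
   and [b n = 2 (m n - m n.+1)], using
   [a n = r n - r n.+1 = (m n - m n.+1) (m n + m n.+1)]. *)
Lemma summable_split (R : realType) (a : nat -> R) B :
  (forall n, 0 <= a n) -> (forall N, series a N <= B) ->
  exists (m b : nat -> R) C,
    [/\ forall n, 0 <= m n, m @ \oo --> (0 : R), forall n, 0 <= b n,
        forall N, series b N <= C & forall n, a n <= b n * m n].
Proof.
move=> a0 aB; have [l al ale] := bounded_series_cvg a0 aB.
pose r n := l - series a n.
have r0 n : 0 <= r n by rewrite subr_ge0.
have rS n : r n = r n.+1 + a n.
  by rewrite /r seriesSr; ring.
have rle n : r n.+1 <= r n by rewrite [r n]rS lerDl.
pose m n := Num.sqrt (r n).
have mle n : m n.+1 <= m n by rewrite ler_sqrt.
have m0 n : 0 <= m n by exact: sqrtr_ge0.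
exists m, (fun n => 2 * (m n - m n.+1)), (2 * m 0); split => //.
- have -> : (0 : R) = Num.sqrt 0 by rewrite sqrtr0.
  apply: (@continuous_cvg _ _ _ _ _ r Num.sqrt 0); first exact: sqrt_continuous.
  by rewrite -(subrr l); apply: cvgB => //; exact: cvg_cst.
- by move=> n; rewrite mulr_ge0// subr_ge0.
- move=> N; rewrite [leLHS](_ : _ = 2 * (m 0 - m N)).
    by rewrite ler_pM2l// lerBlDr lerDl.
  elim: N => [|N IH]; first by rewrite seriesEnat /= big_geq//; ring.
  by rewrite seriesSr IH; ring.
- move=> n; have -> : a n = m n ^+ 2 - m n.+1 ^+ 2.
    by rewrite !sqr_sqrtr// rS; ring.
  rewrite subr_sqr -mulrA [leRHS]mulrCA; apply: ler_wpM2l.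
    by rewrite subr_ge0.
  by rewrite mulr2n mulrDl mul1r lerD2l.
Qed.

(** A filter that does not cluster at [l] contains a set missing a neighbourhood of [l], hence lives
    on finitely many of the [u n]. *)
Lemma compact_null_range (X : topologicalType) (u : nat -> X) (l : X) :
  u @ \oo --> l -> compact (l |` range u).
Proof.
move=> ul F PF FA; have [Fl|Fl] := pselect (cluster F l).
  by exists l; split => //; left.
have [A [B [FA' Bl AB]]] : exists A B, [/\ F A, nbhs l B & A `&` B = set0].
  apply: contrapT => h; apply: Fl => A B FA' Bl; apply/set0P/eqP => AB.
  by apply: h; exists A, B.
have [N _ uN] := ul _ Bl.
have FE : F (u @` `I_N).
  apply: filterS (filterI FA' FA) => x [Ax lux].
  have nB : ~ B x by move=> Bx; have : (A `&` B) x by []; rewrite AB.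
  case: lux => [xl|[n _ unx]].
    by case: nB; rewrite xl; exact: nbhs_singleton.
  exists n => //=; rewrite ltnNge; apply/negP => Nn; apply: nB.
  by rewrite -unx; exact: uN.
have [x [[n /= nN <-] Fu]] := @finite_compact _ (u @` `I_N)
  (finite_image _ (finite_II N)) F PF FE.
by exists (u n); split => //; right; exists n.
Qed.

Lemma cvg_sum_ord (K : numFieldType) (W : normedModType K) m
    (F : nat -> nat -> W) (l : nat -> W) :
  (forall i, F i @ \oo --> l i) ->
  (fun N => \sum_(i < m) F i N) @ \oo --> \sum_(i < m) l i.
Proof.
move=> Fl; elim: m => [|m IH].
  rewrite (_ : (fun _ => _) = fun=> 0) ?big_ord0; first exact: cvg_cst.
  by apply/funext => N; rewrite big_ord0.
rewrite big_ord_recr (_ : (fun _ => _) = (fun N => \sum_(i < m) F i N) \+ F m).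
  exact: cvgD.
by apply/funext => N; rewrite big_ord_recr.
Qed.

Section Nuclear.
Variables (R : realType) (K : numFieldType) (S : scalars R K).
Variable X : normedModType K.
Local Notation "t %:K" := (emb S t) (at level 1, format "t %:K").
Local Notation nrm := (nrm S).

(** Replaces the supremum in [K] by a real number [phi]. As it need not be attained, the last clause
    offers a vector that norms [f] up to the factor 2. *)
Lemma functional_normP (f : {linear X -> K^o}) : bounded_functional f ->
  exists phi : R, [/\ 0 <= phi, functional_norm f = phi%:K,
    forall x, nrm (f x) <= phi * nrm x &
    exists2 x, nrm x <= 1 & phi <= 2 * nrm (f x)].
Proof.
move=> /(bounded_nrmP S)[C C0 fC].
pose A := [set nrm (f x) | x in [set x | nrm x <= 1]].
have A0 : A 0 by exists 0; rewrite /= ?nrm0// linear0 nrm0.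
have Aub : ubound A C.
  move=> _ [x /= x1 <-]; apply: le_trans (fC x) _.
  by rewrite ler_piMr.
have Asup : has_sup A by split; [exists 0|exists C].
have le_sup x : nrm x <= 1 -> nrm (f x) <= sup A.
  by move=> x1; apply: sup_upper_bound => //; exists x.
have phi0 : 0 <= sup A by exact: sup_upper_bound.
exists (sup A); split=> //.
- have sA : supremums [set `|f x : K| | x in [set x : X | `|x| <= 1]]
      (sup A)%:K.
    split=> [_ [x /= x1 <-]|y /= uy].
      by rewrite [leLHS](normE S (f x : K^o)) emb_le le_sup// nrm_le rmorph1.
    (* An upper bound in [K] dominates the value at the zero vector, so it is nonnegative and comes
       from a real number. *)
    have y0 : 0 <= y.
      have := uy `|f 0 : K|; rewrite linear0 normr0; apply.
      by exists 0 => //=; rewrite ?normr0// linear0 normr0.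
    rewrite -(reK S y0) emb_le; apply: ge_sup; first by exists 0.
    move=> _ [x /= x1 <-]; apply: re_le => //; apply: uy; exists x => //=.
    by move: x1; rewrite nrm_le rmorph1.
  rewrite /functional_norm /supremum ifF.
    exact: xget_subset1 sA (@is_subset1_supremums _ _ _).
  apply/negbTE/set0P; exists `|f 0 : K|, 0 => //=; by rewrite normr0.
- move=> x; have [->|x0] := eqVneq x 0; first by rewrite linear0 !nrm0 mulr0.
  have nx0 : 0 < nrm x by rewrite lt_neqAle nrm_ge0 andbT eq_sym nrm_eq0.
  have := le_sup ((nrm x)^-1%:K *: x).
  rewrite linearZ !nrmZ nrm_emb ?invr_ge0 ?nrm_ge0// mulVf ?gt_eqF//.
  by rewrite lexx ler_pdivrMl// mulrC => /(_ isT).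
- have [s0|s0] := eqVneq (sup A) 0.
    by exists 0; rewrite ?nrm0// s0 mulr_ge0// nrm_ge0.
  have sp : 0 < sup A / 2 by rewrite divr_gt0// lt_neqAle eq_sym s0.
  have [_ [x /= x1 <-] sx] := sup_adherent sp Asup.
  by exists x => //; lra.
Qed.

Variable T : {linear X -> X}.
Variables (f : nat -> {linear X -> K^o}) (v : nat -> X).

Lemma nuclear_bounds : nuclear_representation T f v ->
  exists (phi : nat -> R) B, [/\ forall n, 0 <= phi n,
    forall n x, nrm (f n x) <= phi n * nrm x &
    forall N, series (fun n => phi n * nrm (v n)) N <= B].
Proof.
move=> [bf + _].
have /choice[phi phiP] n := functional_normP (bf n).
move=> /cvg_seq_bounded/pinfty_ex_gt0[M M0 /= fM].
exists phi, (re S M); split=> [n|n|N].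
- by have [] := phiP n.
- by have [] := phiP n.
- have := fM N I.
  rewrite (_ : series _ N = (series (fun n => phi n * nrm (v n)) N)%:K).
    rewrite -(emb_le S) (reK S (ltW M0)) => /(le_trans _); apply.
    rewrite real_ler_norm// ger0_real// emb_ge0 seriesEnat sumr_ge0// => n _.
    by rewrite mulr_ge0 ?nrm_ge0//; have [] := phiP n.
  rewrite !seriesEnat /= rmorph_sum; apply: eq_bigr => n _.
  by have [_ -> _ _] := phiP n; rewrite rmorphM -normE.
Qed.

(** This is tr(U T) = tr(T U), with the left side computed from the representation of [T] and the
    right side from that of [U]. The right side does not mention [f] and [v], which is what makes
    the trace of [T] comparable across representations. *)
Lemma nuclear_tensor_trace (U : X -> X) m g w :
  nuclear_representation T f v ->
  (forall i, bounded_functional (g i)) -> U =1 tensor_sum m g w ->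
  series (fun n => f n (U (v n)) : K^o) @ \oo -->
    (\sum_(i < m) g i (T (w i)) : K^o).
Proof.
move=> [_ _ fvT] bg UE.
rewrite (_ : series _ = fun N => \sum_(i < m)
    (g i (series (fun n => (f n (w i) : K) *: v n) N) : K^o)).
  apply: (@cvg_sum_ord K K^o m
    (fun i N => g i (series (fun n => (f n (w i) : K) *: v n) N))
    (fun i => g i (T (w i)))) => i.
  apply: (@continuous_cvg _ _ _ _ _ _ (g i)); last exact: fvT.
  exact: (bounded_linear_continuous (bg i)).
apply/funext => N; under eq_bigr do rewrite seriesEnat /= linear_sum.
rewrite exchange_big seriesEnat /=; apply: eq_bigr => n _ /=.
rewrite UE linear_sum; apply: eq_bigr => i _ /=.
by rewrite !linearZ /= [RHS]mulrC.
Qed.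

(* Rescaling [v n] to a null sequence with summable [f n] makes
   [U |-> \sum_n f n (U (v n))] continuous for uniform convergence on the
   compact set [A]. *)
Lemma trace_approx (t : K^o) : nuclear_representation T f v ->
  series (fun n => f n (v n) : K^o) @ \oo --> t ->
  exists (A : set X) C, [/\ compact A, 0 <= C &
    forall (U : {linear X -> X}) m g w e,
      (forall i, bounded_functional (g i)) -> U =1 tensor_sum m g w ->
      (forall x, A x -> nrm (U x - x) <= e) ->
      nrm (t - (\sum_(i < m) g i (T (w i)) : K^o)) <= C * e].
Proof.
move=> rep ft; have [phi [B [phi0 fphi fB]]] := nuclear_bounds rep.
have [|k [b [C [k0 kcvg b0 bC ab]]]] := summable_split _ fB.
  by move=> n; rewrite mulr_ge0 ?nrm_ge0.
(* [v n] rescaled to norm [k n]; division by zero yields 0, so [v n = 0] gives [u n = 0] and the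
   next bound is only an inequality. *)
pose u n := (k n / nrm (v n))%:K *: v n.
have uk n : nrm (u n) <= k n.
  rewrite nrmZ nrm_emb ?divr_ge0 ?nrm_ge0//.
  have [->|v0] := eqVneq (nrm (v n)) 0; first by rewrite mulr0.
  by rewrite divfK.
have u0 : u @ \oo --> (0 : X).
  apply/(cvg_nrmP S) => e e0; move/cvgrPdist_le : kcvg => /(_ e e0)[N _ kN].
  exists N => n /kN /=; rewrite !sub0r normrN nrmN ger0_norm//.
  exact: le_trans (uk n).
exists ((0 : X) |` range u), C; split.
- exact: compact_null_range.
- by apply: le_trans (bC 0); rewrite seriesEnat /= big_geq.
move=> U m g w e bg UE Ue.
have e0 : 0 <= e by apply: le_trans (Ue 0 (or_introl erefl)); exact: nrm_ge0.
apply: (cvg_nrm_le (cvgB ft (nuclear_tensor_trace rep bg UE))) => N /=.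
rewrite [X in nrm X](_ : _ = \sum_(0 <= n < N) (f n (v n - U (v n)) : K^o)).
  apply: le_trans (nrm_sum _ _ _ _) _.
  apply: (@le_trans _ _ (\sum_(0 <= n < N) (b n * e))); last first.
    by rewrite -mulr_suml ler_wpM2r//; have := bC N; rewrite seriesEnat.
  apply: ler_sum => n _; rewrite -nrmN -linearN opprB.
  have Uu : nrm (U (u n) - u n) <= e by apply: Ue; right; exists n.
  have [v0|v0] := eqVneq (v n) 0.
    by rewrite v0 linear0 subr0 linear0 nrm0 mulr_ge0.
  have nv : 0 < nrm (v n) by rewrite lt_neqAle nrm_ge0 andbT eq_sym nrm_eq0.
  apply: le_trans (fphi _ _) _.
  (* Here [u n] is 0 and cannot recover [v n], but then [phi n * nrm (v n) <= b n * 0] forces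
     [phi n = 0]. *)
  have [kn|kn] := eqVneq (k n) 0.
    have p0 : phi n = 0.
      apply/le_anti; rewrite phi0 andbT -(pmulr_lle0 _ nv).
      by have := ab n; rewrite kn mulr0.
    by rewrite p0 mul0r mulr_ge0.
  have kp : 0 < k n by rewrite lt_neqAle eq_sym kn k0.
  have vE : v n = (nrm (v n) / k n)%:K *: u n.
    by rewrite scalerA -rmorphM mulrA divfK ?divff ?gt_eqF// rmorph1 scale1r.
  rewrite vE linearZ -scalerBr nrmZ nrm_emb ?(divr_ge0 (nrm_ge0 _ _) (k0 n))//.
  rewrite !mulrA; apply: ler_pM => //.
    by rewrite mulr_ge0 ?invr_ge0 ?mulr_ge0 ?nrm_ge0.
    exact: nrm_ge0.
  by rewrite ler_pdivrMr.
by under eq_bigr do rewrite linearB; rewrite sumrB.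
Qed.
End Nuclear.

(** * From the pair property to vanishing traces, and uniqueness of the trace *)

(** In the rank factorization of [M] the column factor has a left inverse and the row factor a right
    inverse. Hence the product of the factors in the opposite order, which has the same trace, is
    [L' *m M *m M *m R']. *)
Lemma mxtrace_sqr0 (K : fieldType) m (M : 'M[K]_m) : M *m M = 0 -> \tr M = 0.
Proof.
move=> MM; have /row_fullP[L' LL] := col_base_full M.
have /row_freeP[R' RR] := row_base_free M.
rewrite -(mulmx_base M) mxtrace_mulC.
suff -> : row_base M *m col_base M = 0 by rewrite mxtrace0.
have LM : L' *m M = row_base M.
  have /(congr1 (mulmx L')) := mulmx_base M.
  by rewrite mulmxA LL mul1mx.
have MR : M *m R' = col_base M.
  have /(congr1 (mulmx^~ R')) := mulmx_base M.
  by rewrite -mulmxA RR mulmx1.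
by rewrite -LM -MR -!mulmxA (mulmxA M) MM mul0mx mulmx0.
Qed.

Lemma net_tails_filter (I : Type) (le : I -> I -> Prop) :
  directed_preorder le -> Filter (net_tails le).
Proof.
move=> [[i0] _ tr dir]; split=> [|A B [i iA] [j jB]|A B AB [i iA]].
- by exists i0.
- have [k [ik jk]] := dir i j; exists k => l kl.
  by split; [apply/iA/(tr _ _ _ ik)|apply/jB/(tr _ _ _ jk)].
- by exists i => j ij; apply/AB/iA.
Qed.

Section NetLimit.
Variables (R : realType) (K : numFieldType) (S : scalars R K).
Variable X : normedModType K.
Local Notation "t %:K" := (emb S t) (at level 1, format "t %:K").
Local Notation nrm := (nrm S).

(** Reduces nets to one compact set and one tolerance at a time. Conversely, the net is indexed by
    pairs of a compact set and a natural number [n], with tolerance [1 / (n + 1)]. *)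
Lemma identity_is_net_limitP (P : {linear X -> X} -> Prop) :
  identity_is_net_limit P <->
  forall (A : set X) (e : R), compact A -> 0 < e ->
    exists2 U, P U & forall x, A x -> nrm (U x - x) <= e.
Proof.
split=> [[I [le [U [dir PU cU]]]] A e cA e0|apx].
  have FF := net_tails_filter dir.
  have /fam_cvgP/(_ A cA) cUA := cU.
  have [|i iU] := cUA [set h | forall y, A y -> ball (idfun y) e%:K (h y)].
    apply/uniform_nbhs; exists [set xy | ball xy.1 e%:K xy.2]; split => //.
    have eK : 0 < e%:K by rewrite emb_gt0.
    exact: (entourage_ball _ (PosNum eK)).
  exists (U i) => // x Ax; rewrite nrmBC nrm_le ltW//.
  have := iU i _ x Ax; rewrite -ball_normE; apply.
  by have [_ + _ _] := dir; exact.
pose I := ({A : set X | compact A} * nat)%type.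
have e0 n : 0 < n.+1%:R^-1 :> R by rewrite invr_gt0 ltr0Sn.
have /choice[U UP] : forall i : I, exists U, P U /\
    forall x, sval i.1 x -> nrm (U x - x) <= i.2.+1%:R^-1.
  by move=> [[A cA] n]; have [U PU AU] := apx A _ cA (e0 n); exists U.
pose le (i j : I) := sval i.1 `<=` sval j.1 /\ (i.2 <= j.2)%N.
have dir : directed_preorder le.
  split.
  - by constructor; exact: (exist _ set0 (@compact0 X), 0).
  - by move=> i; split.
  - move=> i j k [ij ij'] [jk jk'].
    by split; [exact: subset_trans jk|exact: leq_trans jk'].
  - move=> [[A cA] n] [[B cB] m].
    exists (exist _ (A `|` B) (compactU cA cB), maxn n m).
    by split; split => /=; rewrite ?leq_maxl ?leq_maxr//.
exists I, le, U; split=> // [i|]; first by have [] := UP i.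
have FF := net_tails_filter dir.
apply/fam_cvgP => A cA Q /uniform_nbhs[E [entE EQ]].
have [d /= d0 dE] : exists2 d : K, 0 < d & [set xy | ball xy.1 d xy.2] `<=` E.
  by move: entE; rewrite -entourage_ballE.
have [N _ NE] := near_infty_natSinv_lt (PosNum (re_gt0 S d0)).
exists (exist _ A cA, N) => -[[B cB] n] [/= AB Nn].
apply: EQ => y Ay; apply: dE => /=; rewrite -ball_normE /=.
rewrite -(reK S (ltW d0)) -nrm_lt nrmBC; apply: le_lt_trans (NE n Nn).
by have [_ ] := UP (exist _ B cB, n); apply; exact: AB.
Qed.

Lemma pair_ap_trace0 (Y : set X) (T : {linear X -> X}) :
  pair_approximation_property Y ->
  range T `<=` Y -> T @` Y = [set 0] -> nuclear_trace T = 0.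
Proof.
move=> /identity_is_net_limitP apY TX TY.
(* Every value that [xget] may select is shown to be 0; its default is 0 as well. *)
rewrite /nuclear_trace; case: xgetP => // t _ [f [v [rep ft]]].
have [A [C [cA C0 AC]]] := trace_approx S rep ft.
apply/eqP; rewrite -(nrm_eq0 S (t : K^o)); apply/eqP/le_anti.
rewrite nrm_ge0 andbT; apply/ler_addgt0Pr => e e0; rewrite add0r.
have [|U [bU fU UY] Ue] := apY A (e / (C + 1)) cA.
  by rewrite divr_gt0// ltr_wpDl.
have [m [g [w [bg UE]]]] := finite_rank_tensor S bU fU.
have := AC U m g w _ bg UE Ue.
suff -> : \sum_(i < m) (g i (T (w i)) : K^o) = 0.
  rewrite subr0 => /le_trans; apply; rewrite mulrCA ler_piMr ?(ltW e0)//.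
  by rewrite ler_pdivrMr ?mul1r ?lerDl// ltr_wpDl.
pose M : 'M[K]_m := \matrix_(i, j) (g i (T (w j)) : K).
have T0 y : Y y -> T y = 0.
  by move=> Yy; have : (T @` Y) (T y) by [exists y]; rewrite TY.
have -> : \sum_(i < m) (g i (T (w i)) : K^o) = \tr M.
  by apply: eq_bigr => i _; rewrite mxE.
apply: mxtrace_sqr0; apply/matrixP => i k; rewrite !mxE.
rewrite (_ : \sum_j _ = g i (T (U (T (w k))))).
  rewrite T0 ?linear0//; apply: UY; exists (T (w k)) => //.
  by apply: TX; exists (w k).
rewrite UE !linear_sum; apply: eq_bigr => j _; rewrite !mxE !linearZ /=.
exact: mulrC.
Qed.

End NetLimit.

Section TraceUnique.
Variables (R : realType) (K : numFieldType) (S : scalars R K).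
Variable X : normedModType K.
Local Notation nrm := (nrm S).

(** Choose [U] close to the identity on the compact sets of both representations: [t] and [t'] are
    then both close to the trace of [T U], a number that depends on [T] and [U] alone. *)
Lemma nuclear_trace_unique (T : {linear X -> X}) f v f' v' (t t' : K) :
  approximation_property X ->
  nuclear_representation T f v -> nuclear_representation T f' v' ->
  series (fun n => f n (v n) : K) @ \oo --> t ->
  series (fun n => f' n (v' n) : K) @ \oo --> t' -> t = t'.
Proof.
move=> /(identity_is_net_limitP S) ap rep rep' ft ft'.
have [A [C [cA C0 AC]]] := trace_approx S rep ft.
have [A' [C' [cA' C0' AC']]] := trace_approx S rep' ft'.
apply/eqP; rewrite -subr_eq0 -(nrm_eq0 S (t - t' : K^o)); apply/eqP/le_anti.
rewrite nrm_ge0 andbT; apply/ler_addgt0Pr => e e0; rewrite add0r.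
have CC : 0 < C + C' + 1 by rewrite ltr_wpDl// addr_ge0.
have [|U [bU fU] Ue] := ap _ (e / (C + C' + 1)) (compactU cA cA').
  by rewrite divr_gt0.
have [m [g [w [bg UE]]]] := finite_rank_tensor S bU fU.
have h1 := AC U m g w _ bg UE (fun x Ax => Ue x (or_introl Ax)).
have h2 := AC' U m g w _ bg UE (fun x Ax => Ue x (or_intror Ax)).
apply: le_trans (nrm_triangle S (t : K^o)
  (\sum_(i < m) g i (T (w i)) : K^o) t') _.
rewrite [X in _ + X <= _]nrmBC; apply: le_trans (lerD h1 h2) _.
rewrite -mulrDl mulrCA ler_piMr ?(ltW e0)//.
by rewrite ler_pdivrMr// mul1r lerDl.
Qed.

Lemma nuclear_traceE (T : {linear X -> X}) f v (t : K) :
  approximation_property X -> nuclear_representation T f v ->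
  series (fun n => f n (v n) : K) @ \oo --> t -> nuclear_trace T = t.
Proof.
move=> ap rep ft; rewrite /nuclear_trace.
case: xgetP => [s _ [f' [v' [rep' fs]]]|].
  exact: (nuclear_trace_unique ap rep' rep fs ft).
by move=> /(_ t) []; exists f, v.
Qed.

End TraceUnique.

(** * Compact sets in the hull of a null sequence *)

Lemma geometric_small (R : realType) (c q e : R) : 0 <= c -> 1 < q -> 0 < e ->
  exists N, forall k, (N <= k)%N -> c * q ^- k <= e.
Proof.
move=> c0 q1 e0; have q0 : 0 < q by exact: lt_trans q1.
have qV : `|q^-1| < 1 by rewrite ger0_norm ?invr_ge0 ?(ltW q0)// invf_lt1.
have /cvgrPdist_le/(_ e e0)[N _ hN] := cvg_geometric c qV.
exists N => k /hN; rewrite /= sub0r normrN exprVn ger0_norm//.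
by rewrite mulr_ge0// invr_ge0 exprn_ge0// ltW.
Qed.

Section CompactHull.
Variables (R : realType) (K : numFieldType) (S : scalars R K).
Variable X : normedModType K.
Local Notation "t %:K" := (emb S t) (at level 1, format "t %:K").
Local Notation nrm := (nrm S).

Lemma compact_net (A : set X) (d : R) : compact A -> 0 < d ->
  exists s : seq X, forall x, A x -> exists2 y, y \in s & nrm (x - y) <= d.
Proof.
rewrite compact_cover => cA d0.
have dK : 0 < d%:K by rewrite emb_gt0.
have [||D' D'A AD'] := cA X A (fun x => ball x d%:K).
- by move=> x _; exact: ball_open.
- by move=> x Ax; exists x => //; exact: ballxx.
exists (finmap.enum_fset D') => x /AD'[y /= yD']; rewrite -ball_normE /= => xy.
by exists y => //; rewrite nrmBC nrm_le ltW.
Qed.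

(* The elements of [G k], listed for all [k], form a null sequence. *)
Lemma enumerate_null (G : nat -> seq X) :
  (forall e : R, 0 < e -> exists k0, forall k x, (k0 <= k)%N ->
     x \in G k -> nrm x <= e) ->
  exists2 v : nat -> X, v @ \oo --> (0 : X) &
    forall k x, x \in G k -> exists n, v n = x.
Proof.
move=> Gnull.
pose v n := if pickle_inv n is Some (k, j) then nth 0 (G k) j else 0 : X.
exists v; last first.
  move=> k x xG; exists (pickle (k, index x (G k))).
  by rewrite /v pickleK_inv nth_index.
apply/(cvg_nrmP S) => e e0; have [k0 Gk0] := Gnull e e0.
(* Past the codes of all entries of the lists before [k0], only small entries and zeros remain. *)
exists (\max_(k < k0) \max_(j < size (G k)) (pickle (k : nat, j : nat)).+1)%N.
move=> n Nn; rewrite sub0r nrmN /v.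
have := @pickle_invK (nat * nat)%type n.
case: (pickle_inv n) => [[k j] /= kjn|_]; last by rewrite nrm0 ltW.
have [jG|jG] := ltnP j (size (G k)); last by rewrite nth_default// nrm0 ltW.
have [kk0|kk0] := leqP k0 k; first by apply: Gk0 kk0 _; rewrite mem_nth.
have := leq_trans (leq_bigmax (Ordinal kk0)) Nn.
move=> /(leq_trans (leq_bigmax (Ordinal jG))) /=.
by rewrite kjn ltnn.
Qed.

(* Every [x] in [A] is [a 0 + \sum_k (a k.+1 - a k)] where [a k] lies in a
   finite [4 ^- k]-net; the vectors [2 ^+ k *: (a k.+1 - a k)] form a null
   sequence. *)
Lemma compact_null_hull (A : set X) : compact A ->
  exists2 v : nat -> X, v @ \oo --> (0 : X) &
    forall (U : {linear X -> X}) (s : R), bounded_operator U ->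
      (forall n, nrm (U (v n)) <= s) -> forall x, A x -> nrm (U x) <= 3 * s.
Proof.
move=> cA.
have /choice[F FA] : forall k : nat, exists s : seq X,
    forall x, A x -> exists2 y, y \in s & nrm (x - y) <= 4 ^- k.
  by move=> k; apply: compact_net => //; rewrite invr_gt0 exprn_gt0.
(* Keeping only differences of norm at most [2 * 4 ^- j] leaves norms at most [2 * 2 ^- j] after
   scaling, and still includes all consecutive differences of approximants of a point of [A]. *)
pose G k := if k is j.+1 then
  [seq (2 ^+ j)%:K *: z | z <- [seq y - x | x <- F j, y <- F j.+1] &
                          nrm z <= 2 * 4 ^- j] else F 0.
have pow2 j : 2 ^+ j * (2 * 4 ^- j) = 2 * 2 ^- j :> R.
  rewrite (_ : 4 = 2 * 2) ?exprMn; last by rewrite -natrM.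
  rewrite invfM mulrCA; congr (_ * _).
  by rewrite mulrA divff ?mul1r// expf_neq0.
have [|v v0 Gv] := enumerate_null (G := G).
  move=> e e0; have [|||N hN] := @geometric_small R 2 2 e; rewrite ?ltr1n//.
  exists N.+1 => -[//|j] x; rewrite ltnS => Nj /mapP[z].
  rewrite mem_filter => /andP[zj _] ->; rewrite nrmZ nrm_emb ?exprn_ge0//.
  apply: le_trans (hN j Nj); rewrite -pow2; apply: ler_wpM2l => //.
exists v => // U s bU Us x Ax.
have /choice[a aP] : forall k, exists y, y \in F k /\ nrm (x - y) <= 4 ^- k.
  by move=> k; have [y yF xy] := FA k x Ax; exists y.
have ax : a @ \oo --> x.
  apply/(cvg_nrmP S) => e e0.
  have [|||N hN] := @geometric_small R 1 4 e; rewrite ?ltr1n//.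
  by exists N => n /hN; rewrite mul1r; exact/le_trans/(aP n).2.
have Uda k : nrm (U (a k.+1) - U (a k)) <= 2 ^- k * s.
  have [|n vn] := Gv k.+1 ((2 ^+ k)%:K *: (a k.+1 - a k)).
    apply/mapP; exists (a k.+1 - a k) => //.
    rewrite mem_filter; apply/andP; split.
      apply: le_trans (nrm_triangle S _ x _) _.
      rewrite nrmBC mulr2n mulrDl mul1r.
      rewrite lerD ?(aP k).2//; apply: le_trans (aP k.+1).2 _.
      rewrite lef_pV2 ?posrE ?exprn_gt0// exprS ler_peMl ?exprn_ge0//.
      by rewrite ler1n.
    by apply/allpairsP; exists (a k, a k.+1); rewrite (aP k).1 (aP k.+1).1.
  have := Us n; rewrite vn linearZ nrmZ nrm_emb ?exprn_ge0// linearB.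
  by rewrite -ler_pdivlMl// exprn_gt0.
(* The constant 3 is 1 for [a 0] plus 2 for the geometric series of the increments. *)
have Ua k : nrm (U (a k)) <= (3 - 2 * 2 ^- k) * s.
  elim: k => [|k IH].
    have [n <-] := Gv 0 (a 0) (aP 0).1; apply: le_trans (Us n) _.
    by rewrite expr0 invr1 mulr1 (_ : 3 - 2 = 1) ?mul1r//; ring.
  rewrite -(subrK (U (a k)) (U (a k.+1))).
  apply: le_trans (nrmD _ _ _) _; apply: le_trans (lerD (Uda k) IH) _.
  rewrite exprS invfM le_eqVlt; apply/orP; left; apply/eqP; field.
  by rewrite expf_neq0.
have Ux : (fun k => U (a k)) @ \oo --> U x.
  by apply: continuous_cvg => //; exact: (bounded_linear_continuous bU).
apply: (cvg_nrm_le Ux) => k; apply: le_trans (Ua k) _.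
have s0 : 0 <= s by exact: le_trans (nrm_ge0 S _) (Us 0).
by apply: ler_wpM2r => //; rewrite gerBl mulr_ge0// invr_ge0 exprn_ge0.
Qed.

End CompactHull.

(** * The space $c_0(X)$ and its dual *)

Section NullSequences.
Variables (K : numFieldType) (X : normedModType K).

Definition null_seq : {pred nat -> X} := [pred u | `[< u @ \oo --> (0 : X) >]].

Lemma null_seqP u : reflect (u @ \oo --> (0 : X)) (u \in null_seq).
Proof. exact: asboolP. Qed.

Lemma null_seq_submod_closed : GRing.submod_closed null_seq.
Proof.
split=> [|a u w /null_seqP u0 /null_seqP w0]; apply/null_seqP.
  exact: cvg_cst.
rewrite -[0](addr0 (0 : X)) -{1}(scaler0 X a).
by apply: cvgD => //; apply: cvgZr.
Qed.

HB.instance Definition _ :=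
  GRing.isSubmodClosed.Build K (nat -> X) null_seq null_seq_submod_closed.

Record c0 := C0 { c0_seq :> nat -> X; c0P : c0_seq \in null_seq }.
HB.instance Definition _ := [isSub for c0_seq].
HB.instance Definition _ := [Choice of c0 by <:].
HB.instance Definition _ := [SubChoice_isSubLmodule of c0 by <:].

Lemma c0D (u w : c0) n : (u + w) n = u n + w n. Proof. by []. Qed.
Lemma c0Z a (u : c0) n : (a *: u) n = a *: u n. Proof. by []. Qed.

End NullSequences.

Section C0Dual.
Variables (R : realType) (K : numFieldType) (S : scalars R K).
Variable X : normedModType K.
Local Notation "t %:K" := (emb S t) (at level 1, format "t %:K").
Local Notation nrm := (nrm S).
Local Notation c0 := (c0 X).

(** A real-valued function on the module [c0], since [hahn_banach] takes its seminorm as an explicit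
    argument. *)
Definition c0_norm (u : c0) : R := sup (range (fun n => nrm (u n))).

Lemma c0_norm_has_sup (u : c0) : has_sup (range (fun n => nrm (u n))).
Proof.
split; first by exists (nrm (u 0)), 0.
have /null_seqP/cvgP/cvg_seq_bounded/pinfty_ex_gt0[M M0 /= uM] := c0P u.
exists (re S M) => _ [n _ <-]; rewrite nrm_le (reK S (ltW M0)).
exact: uM.
Qed.

Lemma nrm_le_c0_norm (u : c0) n : nrm (u n) <= c0_norm u.
Proof. by apply: sup_upper_bound; [exact: c0_norm_has_sup|exists n]. Qed.

Lemma c0_norm_le (u : c0) c : (forall n, nrm (u n) <= c) -> c0_norm u <= c.
Proof.
move=> uc; apply: ge_sup; first by exists (nrm (u 0)), 0.
by move=> _ [n _ <-].
Qed.

Lemma c0_norm_ge0 u : 0 <= c0_norm u.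
Proof. exact: le_trans (nrm_ge0 S _) (nrm_le_c0_norm u 0). Qed.

Lemma c0_norm_seminorm : seminorm S c0_norm.
Proof.
have le_scale a u : c0_norm (a *: u) <= nrm (a : K^o) * c0_norm u.
  apply: c0_norm_le => n; rewrite c0Z nrmZ.
  apply: ler_wpM2l; first exact: nrm_ge0.
  exact: nrm_le_c0_norm.
split=> [u w|a u].
  apply: c0_norm_le => n; apply: le_trans (nrmD _ _ _) _.
  by rewrite lerD// nrm_le_c0_norm.
apply/le_anti; rewrite le_scale/=.
have [->|a0] := eqVneq a 0.
  by rewrite normr0 re0 mul0r c0_norm_ge0.
have := le_scale a^-1 (a *: u); rewrite scalerA mulVf// scale1r.
have aV : nrm (a : K^o) * nrm (a^-1 : K^o) = 1.
  by rewrite /nrm -reMpos// -normrM mulfV// normr1 re1.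
move=> /(ler_wpM2l (nrm_ge0 S (a : K^o))).
by rewrite mulrA aV mul1r.
Qed.

Definition trunc_seq N (u : nat -> X) n := if (n < N)%N then u n else 0.

Lemma trunc_seq_null N u : trunc_seq N u \in @null_seq K X.
Proof.
apply/null_seqP/(cvg_nrmP S) => e e0; exists N => n Nn.
by rewrite /trunc_seq ltnNge Nn subr0 nrm0 ltW.
Qed.

Definition trunc N u : c0 := C0 (trunc_seq_null N u).

Lemma single_null n x : (fun k => if k == n then x else 0) \in @null_seq K X.
Proof.
apply/null_seqP/(cvg_nrmP S) => e e0; exists n.+1 => k nk.
by rewrite gtn_eqF// subr0 nrm0 ltW.
Qed.

Definition single n x : c0 := C0 (single_null n x).

Lemma single_linear n : linear (single n).
Proof.
move=> a x y; apply/val_inj/funext => k.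
change (single n (a *: x + y) k = a *: single n x k + single n y k) => /=.
by case: eqP => // _; rewrite scaler0 addr0.
Qed.

Lemma truncS N u : trunc N.+1 u = trunc N u + single N (u N).
Proof.
apply/val_inj/funext => k.
change (trunc N.+1 u k = trunc N u k + single N (u N) k).
rewrite /= /trunc_seq ltnS leq_eqVlt.
by case: eqVneq => [->|_] /=; rewrite ?ltnn ?add0r ?addr0.
Qed.

Lemma trunc0 u : trunc 0 u = 0.
Proof. by apply/val_inj/funext => k /=. Qed.

Lemma c0_norm_single n x : c0_norm (single n x) <= nrm x.
Proof.
by apply: c0_norm_le => k /=; case: eqP => // _; rewrite nrm0 nrm_ge0.
Qed.

(** [f n] is [Psi] on the sequences supported at [n]. Summability is stated for arbitrary vectors of
    the unit ball, from which that of the norms follows by near-norming choices. The series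
    represents [Psi] because truncations of a null sequence converge to it in [c0_norm]. *)
Lemma c0_dual (Psi : {linear c0 -> K^o}) (C : R) : 0 <= C ->
  (forall u, nrm (Psi u) <= C * c0_norm u) ->
  exists f : nat -> {linear X -> K^o},
    [/\ forall n x, nrm (f n x) <= C * nrm x,
        forall x : nat -> X, (forall n, nrm (x n) <= 1) ->
          forall N, series (fun n => nrm (f n (x n))) N <= C &
        forall u : c0,
          series (fun n => f n (u n) : K^o) @ \oo --> (Psi u : K^o)].
Proof.
move=> C_ge0 PsiC.
have /choice[f fE] : forall n, exists f : {linear X -> K^o},
    forall x, f x = Psi (single n x).
  move=> n; apply: (@linear_pack K X K^o) => a x y.
  by rewrite single_linear linearP.
have Psi_trunc u N : series (fun n => f n (u n) : K^o) N = Psi (trunc N u).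
  elim: N => [|N IH]; first by rewrite seriesEnat /= big_geq// trunc0 linear0.
  by rewrite seriesSr IH truncS linearD fE.
exists f; split => [n x|x x1 N|u].
- rewrite fE; apply: le_trans (PsiC _) _; apply: ler_wpM2l => //.
  exact: c0_norm_single.
(* These scalars align the terms, so that the partial sum of absolute values is [Psi] at one
   finitely supported sequence of norm at most 1. *)
- pose s n : K := `|f n (x n) : K| / (f n (x n) : K).
  have s1 n : nrm (s n : K^o) <= 1.
    rewrite nrm_le rmorph1 /s normrM normfV normr_id.
    by have [->|h] := eqVneq `|f n (x n) : K| 0; rewrite ?mul0r// divff.
  have sf n : f n (s n *: x n) = (nrm (f n (x n)))%:K :> K.
    rewrite linearZ -normE; have [h|h] := eqVneq (f n (x n) : K) 0.
      by rewrite h normr0; exact: mulr0.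
    exact: divfK.
  have sx n : nrm (s n *: x n) <= 1.
    by rewrite nrmZ mulr_ile1 ?nrm_ge0.
  have := PsiC (trunc N (fun n => s n *: x n)); rewrite -Psi_trunc.
  have -> : series (fun n => f n (s n *: x n) : K^o) N =
      (series (fun n => nrm (f n (x n))) N)%:K.
    by rewrite !seriesEnat /= rmorph_sum; apply: eq_bigr => n _; exact: sf.
  rewrite nrm_emb; last first.
    by rewrite seriesEnat /= sumr_ge0// => n _; exact: nrm_ge0.
  move=> /le_trans; apply; rewrite ler_piMr//; apply: c0_norm_le => n /=.
  by rewrite /trunc_seq; case: ifP => // _; rewrite nrm0.
- apply/(cvg_nrmP S) => e e0; have /null_seqP/(cvg_nrmP S) u0 := c0P u.
  have C1 : 0 < C + 1 by rewrite ltr_wpDl.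
  have [|N uN] := u0 (e / (C + 1)); first by rewrite divr_gt0.
  exists N => n Nn; rewrite Psi_trunc -linearB; apply: le_trans (PsiC _) _.
  apply: (@le_trans _ _ (C * (e / (C + 1)))); last first.
    by rewrite mulrCA ler_piMr ?(ltW e0)// ler_pdivrMr// mul1r lerDl.
  apply: ler_wpM2l => //; apply: c0_norm_le => k.
  rewrite (_ : (u - trunc n u) k = u k - trunc_seq n u k)//.
  rewrite /trunc_seq; case: ltnP => nk.
    by rewrite subrr nrm0 divr_ge0// ltW.
  by have := uN k (leq_trans Nn nk); rewrite sub0r nrmN subr0.
Qed.

End C0Dual.

(** * From vanishing traces to the pair property *)

Lemma finite_rankD (K : numFieldType) (X : normedModType K)
    (U U' : {linear X -> X}) :
  finite_rank U -> finite_rank U' -> finite_rank (U \+ U' : {linear X -> X}).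
Proof.
move=> [m [v vU]] [n [w wU]].
exists (m + n)%N, (fun i : 'I_(m + n) =>
  match fintype.split i with inl j => v j | inr j => w j end).
move=> x; have [c cE] := vU x; have [d dE] := wU x.
exists (fun i : 'I_(m + n) =>
  match fintype.split i with inl j => c j | inr j => d j end).
rewrite /= cE dE big_split_ord /=; congr (_ + _); apply: eq_bigr => i _.
  by have := unsplitK (inl i : 'I_m + 'I_n); rewrite /= => ->.
by have := unsplitK (inr i : 'I_m + 'I_n); rewrite /= => ->.
Qed.

Lemma finite_rankZ (K : numFieldType) (X : normedModType K) a
    (U : {linear X -> X}) :
  finite_rank U -> finite_rank (a \*: U : {linear X -> X}).
Proof.
move=> [m [v vU]]; exists m, v => x; have [c cE] := vU x.
exists (fun i => a * c i); rewrite /= cE scaler_sumr.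
by apply: eq_bigr => i _; rewrite scalerA.
Qed.

Section Converse.
Variables (R : realType) (K : numFieldType) (S : scalars R K).
Local Notation "t %:K" := (emb S t) (at level 1, format "t %:K").
Local Notation nrm := (nrm S).

Lemma bounded_operatorD (X : normedModType K) (U U' : {linear X -> X}) :
  bounded_operator U -> bounded_operator U' ->
  bounded_operator (U \+ U' : {linear X -> X}).
Proof.
move=> /(bounded_nrmP S)[C C0 UC] /(bounded_nrmP S)[D D0 UD].
apply/(bounded_nrmP S); exists (C + D); first exact: addr_ge0.
by move=> x /=; apply: le_trans (nrmD _ _ _) _; rewrite mulrDl lerD.
Qed.

Lemma bounded_operatorZ (X : normedModType K) a (U : {linear X -> X}) :
  bounded_operator U -> bounded_operator (a \*: U : {linear X -> X}).
Proof.
move=> /(bounded_nrmP S)[C C0 UC].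
apply/(bounded_nrmP S); exists (nrm (a : K^o) * C).
  by rewrite mulr_ge0// nrm_ge0.
by move=> x /=; rewrite nrmZ -mulrA ler_wpM2l// nrm_ge0.
Qed.

Lemma rank_one_operator (X : normedModType K) (g : {linear X -> K^o}) (w : X) :
  bounded_functional g ->
  exists U : {linear X -> X}, [/\ bounded_operator U, finite_rank U &
    forall x, U x = (g x : K) *: w].
Proof.
move=> /(bounded_nrmP S)[C C0 gC].
have [U UE] : exists U : {linear X -> X}, U =1 (fun x => (g x : K) *: w).
  apply: (@linear_pack K X X) => a x y.
  by rewrite linearP scalerDl scalerA.
exists U; split => //.
  apply/(bounded_nrmP S); exists (C * nrm w).
    by rewrite mulr_ge0// nrm_ge0.
  by move=> x; rewrite UE nrmZ mulrAC ler_wpM2r ?nrm_ge0.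
by exists 1, (fun=> w) => x; exists (fun=> g x); rewrite big_ord1 UE.
Qed.

Lemma abs_series_cvg (X : completeNormedModType K) (u : nat -> X)
    (a : nat -> R) B :
  (forall n, nrm (u n) <= a n) -> (forall N, series a N <= B) ->
  cvgn (series u).
Proof.
move=> ua aB; have a0 n : 0 <= a n by exact: le_trans (nrm_ge0 S _) (ua n).
have [l al _] := bounded_series_cvg a0 aB.
have /cauchy_cvgP/cauchy_seriesP ca : cvgn (series a) by apply/cvg_ex; exists l.
apply/cauchy_cvgP/cauchy_seriesP => e e0.
apply: filterS (ca _ (re_gt0 S e0)) => -[m n] /= mn.
rewrite -(reK S (ltW e0)) -nrm_lt; apply: le_lt_trans (nrm_sum _ _ _ _) _.
apply: le_lt_trans mn; apply: le_trans (ler_norm _); exact: ler_sum.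
Qed.

(** Completeness of [X] enters here: the series defining [T x] is absolutely convergent, with terms
    bounded by [phi n * (nrm x * D)]. *)
Lemma nuclear_representation_of_bounds (X : completeNormedModType K)
    (f : nat -> {linear X -> K^o}) (v : nat -> X) (phi : nat -> R) (B D : R) :
  (forall n, 0 <= phi n) -> (forall n, functional_norm (f n) = (phi n)%:K) ->
  (forall n x, nrm (f n x) <= phi n * nrm x) ->
  (forall N, series phi N <= B) -> (forall n, nrm (v n) <= D) ->
  exists T : {linear X -> X},
    bounded_operator T /\ nuclear_representation T f v.
Proof.
move=> phi0 fphi fle phiB vD.
have D0 : 0 <= D by exact: le_trans (nrm_ge0 S _) (vD 0).
have B0 : 0 <= B by apply: le_trans (phiB 0); rewrite seriesEnat /= big_geq.
have le_term n x : nrm ((f n x : K) *: v n) <= phi n * (nrm x * D).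
  rewrite nrmZ mulrA; apply: ler_pM => //; exact: nrm_ge0.
have le_series c N : 0 <= c -> series (fun n => phi n * c) N <= B * c.
  move=> c0; rewrite seriesEnat /= -mulr_suml ler_wpM2r//.
  by have := phiB N; rewrite seriesEnat.
have nD (x : X) : 0 <= nrm x * D by rewrite mulr_ge0// nrm_ge0.
have cT x : cvgn (series (fun n => (f n x : K) *: v n)).
  apply: (@abs_series_cvg X _ (fun n => phi n * (nrm x * D))
    (B * (nrm x * D))) => // N.
  exact: le_series.
have [T TE] : exists T : {linear X -> X},
    T =1 (fun x => limn (series (fun n => (f n x : K) *: v n))).
  apply: (@linear_pack K X X) => a x y.
  apply: cvg_lim; first exact: norm_hausdorff.
  rewrite (_ : series _ = a \*: series (fun n => (f n x : K) *: v n) \+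
                         series (fun n => (f n y : K) *: v n)).
    by apply: cvgD; [apply: cvgZr; exact: cT|exact: cT].
  apply/funext => N; rewrite !seriesEnat /= scaler_sumr -big_split /=.
  by apply: eq_bigr => n _; rewrite linearP scalerDl scalerA.
have Tcvg x : series (fun n => (f n x : K) *: v n) @ \oo --> T x.
  by rewrite TE; exact: cT.
exists T; split.
  apply/(bounded_nrmP S); exists (B * D); first exact: mulr_ge0.
  move=> x; apply: (cvg_nrm_le (Tcvg x)) => N.
  rewrite seriesEnat /=; apply: le_trans (nrm_sum _ _ _ _) _.
  apply: le_trans (ler_sum _ (fun n _ => le_term n x)) _.
  have := le_series _ N (nD x); rewrite seriesEnat /= => /le_trans; apply.
  by rewrite mulrA mulrAC.
split=> //.
  by move=> n; apply/(bounded_nrmP S); exists (phi n).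
have [|N|l al _] := @bounded_series_cvg R (fun n => phi n * nrm (v n)) (B * D).
- by move=> n; rewrite mulr_ge0// nrm_ge0.
- apply: le_trans (le_series D N D0); rewrite !seriesEnat /=.
  by apply: ler_sum => n _; rewrite ler_wpM2l.
apply/cvg_ex; exists (l%:K : K^o); apply/(cvg_nrmP S) => e e0.
move/cvgrPdist_le : al => /(_ e e0)[N _ lN]; exists N => n /lN /=.
rewrite (_ : series _ n = (series (fun n => phi n * nrm (v n)) n)%:K); last first.
  rewrite !seriesEnat /= rmorph_sum; apply: eq_bigr => i _.
  by rewrite fphi rmorphM -normE.
rewrite -rmorphB => h; apply: le_trans _ h.
have [ge0|/ltW le0] := leP 0 (l - series (fun n => phi n * nrm (v n)) n).
  by rewrite nrm_emb// ger0_norm.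
by rewrite -nrmN -rmorphN nrm_emb ?oppr_ge0// ler0_norm.
Qed.
Lemma trace0_pair_ap (X : completeNormedModType K) (Y : set X) :
  closed_subspace Y -> approximation_property X ->
  (forall T : {linear X -> X}, nuclear T ->
     range T `<=` Y -> T @` Y = [set 0] -> nuclear_trace T = 0) ->
  pair_approximation_property Y.
Proof.
move=> sY ap tr0; apply/(identity_is_net_limitP S) => A e cA e0.
have Y0 : Y 0 by have [_ [+ _]] := sY; rewrite inE.
have YL a y z : Y y -> Y z -> Y (a *: y + z).
  by have [_ [_ YD]] := sY; move=> Yy Yz; have := YD a y z; rewrite !inE; exact.
apply: contrapT => noU.
have [v v0 hull] := compact_null_hull S cA.
pose vc : c0 X := C0 (introT (null_seqP v) v0).
pose P (U : {linear X -> X}) :=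
  [/\ bounded_operator U, finite_rank U & U @` Y `<=` Y].
pose M := [set u : c0 X | exists2 U, P U & forall n, u n = U (v n)].
have [zero zeroE] : exists U : {linear X -> X}, U =1 (fun=> 0).
  by apply: (@linear_pack K X X) => a x y; rewrite scaler0 addr0.
have M0 : M 0.
  exists zero; last by move=> n; rewrite zeroE.
  split=> [||_ [y _ <-]]; last by rewrite zeroE.
    by apply/(bounded_nrmP S); exists 0 => // x; rewrite zeroE nrm0 mul0r.
  by exists 0, (fun=> 0) => x; exists (fun=> 0); rewrite zeroE big_ord0.
have MD u w : M u -> M w -> M (u + w).
  move=> [U [bU fU UY] uU] [W [bW fW WY] wW]; exists (U \+ W : {linear X -> X}).
    split; [exact: bounded_operatorD|exact: finite_rankD|].
    move=> _ [y Yy <-] /=; rewrite -(scale1r (U y)); apply: YL.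
      by apply: UY; exists y.
    by apply: WY; exists y.
  by move=> n; rewrite c0D uU wW.
have MZ a u : M u -> M (a *: u).
  move=> [U [bU fU UY] uU]; exists (a \*: U : {linear X -> X}).
    split; [exact: bounded_operatorZ|exact: finite_rankZ|].
    move=> _ [y Yy <-] /=; rewrite -[_ *: _]addr0; apply: YL => //.
    by apply: UY; exists y.
  by move=> n; rewrite c0Z uU.
(* Passing from the null sequence to [A] costs the factor 3, and [3 * (e / 4) <= e]. *)
have e4 : 0 < e / 4 by rewrite divr_gt0.
have Mdist m : M m -> e / 4 <= c0_norm S (vc - m).
  move=> [U PU mU]; rewrite leNgt; apply/negP => lt4; apply: noU.
  exists U => // x Ax; have [bU fU UY] := PU.
  have [W WE] : exists W : {linear X -> X}, W =1 (fun x => U x - x).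
    apply: (@linear_pack K X X) => a y z.
    by rewrite linearP scalerBr opprD addrACA.
  have bW : bounded_operator W.
    have /(bounded_nrmP S)[C C0 UC] := bU.
    apply/(bounded_nrmP S); exists (C + 1); first by rewrite addr_ge0.
    move=> y; rewrite WE mulrDl mul1r; apply: le_trans (nrmB _ _ _) _.
    by rewrite lerD2r.
  rewrite -WE; apply: le_trans (hull W (e / 4) bW _ x Ax) _; last by lra.
  move=> n; rewrite WE nrmBC -mU; apply: le_trans (ltW lt4).
  exact: (nrm_le_c0_norm S (vc - m) n).
have [Psi [C [C_gt0 PsiM Psiv PsiC]]] :=
  hahn_banach (c0_norm_seminorm S X) M0 MD MZ e4 Mdist.
have [|f [fC fsum fPsi]] := @c0_dual _ _ S X Psi C (ltW C_gt0).
  by move=> u; rewrite nrm_le; exact: PsiC.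
have bf n : bounded_functional (f n).
  by apply/(bounded_nrmP S); exists C => //; exact: ltW.
have /choice[phi phiP] n := functional_normP S (bf n).
(* Vectors norming the [f n] up to 2 turn the bound [C] of [fsum] into [2 * C] for the sum of the
   norms. *)
have /choice[x xP] : forall n, exists x, nrm x <= 1 /\ phi n <= 2 * nrm (f n x).
  by move=> n; have [_ _ _ [x x1 phix]] := phiP n; exists x.
have [|||||T [bT rep]] :=
  @nuclear_representation_of_bounds X f v phi (2 * C) (c0_norm S vc).
- by move=> n; have [] := phiP n.
- by move=> n; have [] := phiP n.
- by move=> n; have [] := phiP n.
- move=> N; have := fsum x (fun n => (xP n).1) N.
  rewrite -(ler_pM2l (ltr0Sn R 1)).
  apply: le_trans; rewrite !seriesEnat /= mulr_sumr.
  by apply: ler_sum => n _; exact: (xP n).2.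
- exact: (nrm_le_c0_norm S vc).
(* For [U = g] tensor [w], the value of [Psi] at the sequence [U (v n)] is [g (T w)], and [Psi]
   vanishes on [M]. Invariance of [Y] holds when [g] is 0 on [Y], and also when [w] is in [Y]; these
   two cases give [TX] and [TY]. *)
have vanish (g : {linear X -> K^o}) w : bounded_functional g ->
    (forall y, Y y -> Y ((g y : K) *: w)) -> g (T w) = 0.
  move=> bg gY; have [U [bU fU UE]] := rank_one_operator w bg.
  have Uv0 : (fun n => U (v n)) \in @null_seq K X.
    apply/null_seqP; rewrite -(linear0 U).
    by apply: continuous_cvg => //; exact: (bounded_linear_continuous bU).
  have PsiU : Psi (C0 Uv0) = 0.
    apply: PsiM; exists U => //; split => // _ [y Yy <-].
    by rewrite UE; exact: gY.
  have UT : U =1 tensor_sum 1 (fun=> g) (fun=> w).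
    by move=> y; rewrite UE /tensor_sum big_ord1.
  have := nuclear_tensor_trace rep (fun=> bg) UT.
  have := fPsi (C0 Uv0); rewrite PsiU big_ord1 /= => h h'.
  exact: cvg_nrm_unique h' h.
have TX : range T `<=` Y.
  move=> _ [y _ <-]; apply: contrapT => YTy.
  have [g [bg gY g1]] := hahn_banach_closed S sY YTy.
  have /eqP : g (T y) = 0 by apply: vanish => // z Yz; rewrite gY// scale0r.
  by rewrite g1 oner_eq0.
have TY : T @` Y = [set 0].
  apply/seteqP; split=> [_ [y Yy <-]|_ ->]; last by exists 0; rewrite ?linear0.
  apply/eqP/negPn/negP => Ty0; have [g bg g1] := hahn_banach_point S Ty0.
  have /eqP : g (T y) = 0.
    by apply: vanish => // z Yz; rewrite -[_ *: _]addr0; exact: YL.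
  by rewrite g1 oner_eq0.
have nT : nuclear T by split => //; exists f, v.
(* The approximation property identifies [Psi vc = 1] with [nuclear_trace T], against the hypothesis
   that it is 0. *)
have trT := nuclear_traceE S ap rep (fPsi vc).
by have := tr0 T nT TX TY; rewrite trT Psiv => /eqP; rewrite oner_eq0.
Qed.

Lemma pair_ap_iff (X : completeNormedModType K) (Y : set X) :
  closed_subspace Y -> approximation_property X ->
  pair_approximation_property Y <->
  (forall T : {linear X -> X}, nuclear T ->
     range T `<=` Y -> T @` Y = [set 0] -> nuclear_trace T = 0).
Proof.
move=> sY ap; split; last exact: trace0_pair_ap.
by move=> pY T _; exact: (pair_ap_trace0 S).
Qed.

End Converse.

(* The first conjunct is the theorem for real Banach spaces, the second for
   complex ones. *)
Theorem theorem2p1 (R : realType) :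
  (forall (X : completeNormedModType R) (Y : set X),
     closed_subspace Y ->
     approximation_property X ->
     (pair_approximation_property Y <->
      (forall T : {linear X -> X}, nuclear T ->
         range T `<=` Y -> T @` Y = [set 0] -> nuclear_trace T = 0)))
  /\
  (forall (X : completeNormedModType R[i]) (Y : set X),
     closed_subspace Y ->
     approximation_property X ->
     (pair_approximation_property Y <->
      (forall T : {linear X -> X}, nuclear T ->
         range T `<=` Y -> T @` Y = [set 0] -> nuclear_trace T = 0))).
Proof.
by split=> X Y sY ap; [exact: (pair_ap_iff (real_scalars R))
                      |exact: (pair_ap_iff (complex_scalars R))].
Qed.
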